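(* Let $n\ge 2$ be an integer and let $w$ be a real number with $-1<w<\frac{1}{n-1}$. Put $c:=\sqrt{(n-1)(w+1)/n}$ and $\ell:=\sqrt{(1-w(n-1))/n}$. Then the simplex $\mathcal{Q}_n(w)$ can be cut into $n$ pieces that can be reassembled to form the prism $c\,\mathcal{P}_{n-1}\times I_{\ell}$; that is, there are polytopes $P_1,\dots,P_n,Q_1,\dots,Q_n\subset\mathbb{R}^n$ with $\mathcal{Q}_n(w)=P_1+\cdots+P_n$ and $c\,\mathcal{P}_{n-1}\times I_\ell=Q_1+\cdots+Q_n$, and isometries $g_1,\dots,g_n$ of $\mathbb{R}^n$ with $g_i(P_i)=Q_i$ for $i=1,\dots,n$.
   Context: For $m\ge1$ and $w>-1$ (with $w<\frac1{m-1}$ if $m\ge2$), let $v_1,\dots,v_m$ be unit vectors in $\mathbb{R}^m$ with $v_i\cdot v_j=-w$ for $i\ne j$. Then $\mathcal{Q}_m(w)$ is the simplex $\{\sum_{i=1}^m\lambda_iv_i : 1\ge\lambda_1\ge\cdots\ge\lambda_m\ge0\}$; it is determined up to isometry by $m$ and $w$. Define $\mathcal{P}_m:=\mathcal{Q}_m(\frac1m)$ (in particular $\mathcal{P}_1$ is an interval of length $1$). For $c>0$, $c\,\mathcal{P}_m$ is the scaled copy $\{cx: x\in\mathcal{P}_m\}$. $I_\ell$ denotes an interval of length $\ell$, and the prism is taken in $\mathbb{R}^{n-1}\times\mathbb{R}=\mathbb{R}^n$. A polytope in $\mathbb{R}^n$ is a union of finitely many bounded $n$-dimensional simplices (not necessarily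 convex or connected). For polytopes, $P=P_1+\cdots+P_k$ means that $P=P_1\cup\cdots\cup P_k$ and the interiors of $P_1,\dots,P_k$ are pairwise disjoint. Isometries may be orientation-reversing. *)

(* Defs.v *)
From mathcomp Require Import all_boot all_order all_algebra.
From mathcomp Require Import all_classical all_reals all_analysis.
From mathcomp Require Import ring lra.

Set Implicit Arguments.
Unset Strict Implicit.
Unset Printing Implicit Defensive.

Import Order.TTheory GRing.Theory Num.Theory.
Import numFieldNormedType.Exports.

Local Open Scope classical_set_scope.
Local Open Scope ring_scope.

(* The norm that the library puts on 'rV[R]_n is the sup norm. It induces the
   usual topology, so the library interior is the right one, but lengths and
   isometries must refer to the Euclidean structure below. *)
Definition dotv (R : realType) (n : nat) (x y : 'rV[R]_n) : R :=
  \sum_(i < n) x 0 i * y 0 i.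

Definition edist (R : realType) (n : nat) (x y : 'rV[R]_n) : R :=
  Num.sqrt (dotv (x - y) (x - y)).

Definition euclidean_isometry (R : realType) (n : nat)
    (g : 'rV[R]_n -> 'rV[R]_n) : Prop :=
  bijective g /\ forall x y, edist (g x) (g y) = edist x y.

Definition affinely_independent (R : realType) (n : nat)
    (p : 'I_n.+1 -> 'rV[R]_n) : Prop :=
  row_free (\matrix_(i < n) (p (lift ord0 i) - p ord0)).

Definition hull (R : realType) (n k : nat) (p : 'I_k -> 'rV[R]_n) :
    set 'rV[R]_n :=
  [set x | exists a : 'I_k -> R,
     [/\ forall i, 0 <= a i, \sum_(i < k) a i = 1
       & x = \sum_(i < k) a i *: p i]].

Definition full_simplex (R : realType) (n : nat) (S : set 'rV[R]_n) : Prop :=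
  exists p : 'I_n.+1 -> 'rV[R]_n, affinely_independent p /\ S = hull p.

(* The union is over at least one simplex, so a polytope is never empty. *)
Definition polytope (R : realType) (n : nat) (P : set 'rV[R]_n) : Prop :=
  exists (k : nat) (S : 'I_k.+1 -> set 'rV[R]_n),
    (forall i, full_simplex (S i)) /\ P = \bigcup_i S i.

(* S = P_1 + ... + P_k *)
Definition dissection (R : realType) (n k : nat) (S : set 'rV[R]_n)
    (P : 'I_k -> set 'rV[R]_n) : Prop :=
  [/\ forall i, polytope (P i), S = \bigcup_i P i
    & trivIset setT (fun i => (P i)°)].

Definition Qframe (R : realType) (m : nat) (w : R) (v : 'I_m -> 'rV[R]_m) :
    Prop :=
  (forall i, dotv (v i) (v i) = 1) /\
  (forall i j, i != j -> dotv (v i) (v j) = - w).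

(* Q_m(w) when v satisfies [Qframe w]; it depends on the choice of v only up to
   isometry. *)
Definition Qsimplex (R : realType) (m : nat) (v : 'I_m -> 'rV[R]_m) :
    set 'rV[R]_m :=
  [set x | exists l : 'I_m -> R,
     [/\ forall i, 0 <= l i <= 1,
         forall i j : 'I_m, (i <= j)%N -> l j <= l i
       & x = \sum_(i < m) l i *: v i]].

Definition scale_set (R : realType) (m : nat) (c : R) (A : set 'rV[R]_m) :
    set 'rV[R]_m :=
  [set c *: x | x in A].

(* A x [0, l] in R^(n-1) x R = R^n, for n >= 1: the first n - 1 coordinates
   form a point of A and the last one, of index n.-1, lies in [0, l]. *)
Definition prism (R : realType) (n : nat) (A : set 'rV[R]_n.-1) (l : R) :
    set 'rV[R]_n :=
  [set x | A (\row_(i < n.-1) x 0 (widen_ord (leq_pred n) i)) /\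
           forall i : 'I_n, i = n.-1 :> nat -> 0 <= x 0 i <= l].

(* Frames exist throughout the admissible range, so quantifying over all of
   them is not vacuous. *)
Lemma Qframe_exists (R : realType) (m : nat) (w : R) :
  (0 < m)%N -> -1 < w -> ((1 < m)%N -> w < (m.-1%:R)^-1) ->
  exists v : 'I_m -> 'rV[R]_m, Qframe w v.
Proof.
case: m => // m _ w1 wm.
have m0 : 0 < m.+1%:R :> R by rewrite ltr0n.
have mw : 0 <= 1 - m%:R * w.
  case: m wm {m0} => [_|m wm]; first by rewrite mul0r subr0.
  rewrite subr_ge0; have /ltW := wm isT.
  by rewrite /= -[X in w <= X]mul1r ler_pdivlMr ?ltr0n// mulrC.
pose a := Num.sqrt (1 + w); pose s := Num.sqrt (1 - m%:R * w).
pose b := (s - a) / m.+1%:R.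
have a2 : a ^+ 2 = 1 + w by rewrite sqr_sqrtr//; lra.
have s2 : s ^+ 2 = 1 - m%:R * w by rewrite sqr_sqrtr.
have bE : m.+1%:R * b = s - a by rewrite /b mulrC divfK ?gt_eqF.
have key : 2 * a * b + m.+1%:R * b ^+ 2 = - w.
  apply: (mulfI (lt0r_neq0 m0)).
  have -> : m.+1%:R * (2 * a * b + m.+1%:R * b ^+ 2) =
    2 * a * (m.+1%:R * b) + (m.+1%:R * b) ^+ 2 by ring.
  rewrite bE.
  have -> : 2 * a * (s - a) + (s - a) ^+ 2 = s ^+ 2 - a ^+ 2 by ring.
  by rewrite s2 a2 -[m.+1%:R]natr1; ring.
have dE (i j : 'I_m.+1) : \sum_(k < m.+1)
    (a * (k == i)%:R + b) * (a * (k == j)%:R + b) =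
    a ^+ 2 * (i == j)%:R + - w.
  rewrite -key.
  under eq_bigr => k _.
    have -> : (a * (k == i)%:R + b) * (a * (k == j)%:R + b) =
      (k == i)%:R * (a ^+ 2 * (k == j)%:R + a * b) +
      ((k == j)%:R * (a * b) + b ^+ 2) by ring.
    over.
  have sumd (i0 : 'I_m.+1) (F : 'I_m.+1 -> R) :
      \sum_(k < m.+1) (k == i0)%:R * F k = F i0.
    rewrite (bigD1 i0)//= eqxx mul1r big1 ?addr0// => k /negbTE ->.
    by rewrite mul0r.
  rewrite !big_split/= sumd (sumd j (fun=> a * b)) sumr_const card_ord.
  by rewrite -[b ^+ 2 *+ _]mulr_natl; ring.
exists (fun i => \row_k (a * (k == i)%:R + b)); split=> [i|i j /negbTE ij].
  rewrite /dotv; under eq_bigr do rewrite !mxE.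
  by rewrite dE eqxx mulr1 a2 addrK.
rewrite /dotv; under eq_bigr do rewrite !mxE.
by rewrite dE ij mulr0 add0r.
Qed.

(* Main.v *)
Require Import Defs.
From mathcomp Require Import all_boot all_order all_algebra.
From mathcomp Require Import all_classical all_reals all_analysis.
From mathcomp Require Import fingroup perm ring lra zify.

Set Implicit Arguments.
Unset Strict Implicit.
Unset Printing Implicit Defensive.

Import Order.TTheory GRing.Theory Num.Theory.
Import numFieldNormedType.Exports.

Local Open Scope classical_set_scope.
Local Open Scope ring_scope.

(** In the coordinates a of the frame v, the motion
    (a_1, ..., a_n) |-> (a_n + 1, a_1, ..., a_(n-1)) is an isometry, because the
    Gram matrix of v is invariant under permutations. It preserves the infinite
    prism T = {a_1 >= ... >= a_n >= a_1 - 1} and raises the sum of the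
    coordinates by 1. Both the simplex {1 >= a_1 >= ... >= a_n >= 0} and the
    slab {0 <= sum a <= 1} of T are fundamental domains for its powers. The
    simplex lies in 0 <= sum a <= n, so cutting it along the hyperplanes where
    sum a is an integer gives n layers, which the powers of the inverse motion
    reassemble into the slab; and the slab is the prism c P_(n-1) x I_l, the
    axis of T being orthogonal to its cross-section. *)

(** * Cutting a simplex by a half-space *)

(** The matrix condition singles out the vertex [ord0]; this form is symmetric in the vertices, so
    that any of them can be moved. *)
Lemma affinely_independentP (R : realType) (n : nat) (p : 'I_n.+1 -> 'rV[R]_n) :
  affinely_independent p <->
  (forall a : 'I_n.+1 -> R, \sum_i a i = 0 -> \sum_i a i *: p i = 0 ->
     forall i, a i = 0).
Proof.
split=> [pfree a a0 ap0|pfree].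
  pose b : 'rV[R]_n := \row_i a (lift ord0 i).
  have b0 : b = 0.
    apply: (row_free_inj pfree); rewrite mul0mx mulmx_sum_row.
    under eq_bigr do rewrite rowK mxE scalerBr.
    rewrite sumrB -scaler_suml.
    move: a0 ap0; rewrite !big_ord_recl /= => /eqP; rewrite addr_eq0 => /eqP ->.
    by rewrite scaleNr addrC => ->.
  have bl i : a (lift ord0 i) = 0 by move/rowP/(_ i): b0; rewrite !mxE.
  move=> i; case: (unliftP ord0 i) => [j ->|->]; first exact: bl.
  by move: a0; rewrite big_ord_recl big1 ?addr0.
apply: inj_row_free => b; rewrite mulmx_sum_row.
under eq_bigr do rewrite rowK scalerBr.
rewrite sumrB -scaler_suml => b0.
pose a i := if unlift ord0 i is Some j then b 0 j else - \sum_j b 0 j.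
have al j : a (lift ord0 j) = b 0 j by rewrite /a liftK.
have a0 : a ord0 = - \sum_j b 0 j by rewrite /a unlift_none.
apply/rowP => j; rewrite -al mxE; apply: pfree.
  by rewrite big_ord_recl; under eq_bigr do rewrite al; rewrite a0 addNr.
rewrite big_ord_recl; under eq_bigr do rewrite al.
by rewrite a0 scaleNr addrC.
Qed.

Definition transfer (R : realType) (k : nat) (a : 'I_k -> R) (i j : 'I_k)
  (s : R) : 'I_k -> R := fun l => a l + s * ((l == i)%:R - (l == j)%:R).

Definition move_vertex (R : realType) (n k : nat) (p : 'I_k -> 'rV[R]_n)
    (i j : 'I_k) (t : R) : 'I_k -> 'rV[R]_n :=
  fun l => if l == j then p j + t *: (p i - p j) else p l.

Lemma sum_delta (R : realType) (k : nat) (V : lmodType R) (i : 'I_k)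
    (p : 'I_k -> V) : \sum_l (l == i)%:R *: p l = p i.
Proof.
rewrite (bigD1 i)//= eqxx scale1r big1 ?addr0// => l /negbTE ->.
by rewrite scale0r.
Qed.

Lemma sum_transfer_scale (R : realType) (k : nat) (V : lmodType R)
    (a : 'I_k -> R) (i j : 'I_k) (s : R) (p : 'I_k -> V) :
  \sum_l transfer a i j s l *: p l = \sum_l a l *: p l + s *: (p i - p j).
Proof.
rewrite /transfer; under eq_bigr do rewrite scalerDl -scalerA scalerBl.
by rewrite big_split/= -scaler_sumr sumrB !sum_delta.
Qed.

Lemma sum_transfer (R : realType) (k : nat) (a : 'I_k -> R) (i j : 'I_k)
  (s : R) : \sum_l transfer a i j s l = \sum_l a l.
Proof.
have := sum_transfer_scale a i j s (fun=> 1 : R^o).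
rewrite subrr scaler0 addr0.
by under eq_bigr do rewrite /GRing.scale/= mulr1; move=> ->;
   under eq_bigr do rewrite /GRing.scale/= mulr1.
Qed.

(** Moving a vertex is dual to shifting barycentric weight between two fixed vertices, so hulls of
    moved vertices can be studied through weights alone. *)
Lemma sum_move_vertex (R : realType) (n k : nat) (a : 'I_k -> R)
    (p : 'I_k -> 'rV[R]_n) (i j : 'I_k) (t : R) :
  \sum_l a l *: move_vertex p i j t l =
  \sum_l transfer a i j (a j * t) l *: p l.
Proof.
rewrite sum_transfer_scale (bigD1 j)//= [in RHS](bigD1 j)//= /move_vertex eqxx.
rewrite (eq_bigr (fun l => a l *: p l)); last by move=> l /negbTE ->.
by rewrite scalerDr scalerA addrAC.
Qed.

Lemma transferE (R : realType) (k : nat) (a : 'I_k -> R) (i j : 'I_k) (s : R) :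
  i != j -> [/\ transfer a i j s i = a i + s, transfer a i j s j = a j - s
    & forall l, l != i -> l != j -> transfer a i j s l = a l].
Proof.
move=> ij; rewrite /transfer !eqxx (negbTE ij) eq_sym (negbTE ij).
split=> [||l /negbTE -> /negbTE ->]; rewrite /= ?mulr1n ?mulr0n; ring.
Qed.

Lemma transfer_ge0 (R : realType) (k : nat) (a : 'I_k -> R) (i j : 'I_k)
    (s : R) : i != j -> (forall l, 0 <= a l) -> - a i <= s -> s <= a j ->
  forall l, 0 <= transfer a i j s l.
Proof.
move=> ij a0 si sj l; have [Ei Ej El] := transferE a s ij.
have [->|li] := eqVneq l i; first by rewrite Ei; lra.
have [->|lj] := eqVneq l j; first by rewrite Ej; lra.
by rewrite El.
Qed.

(** In a vanishing combination the weight of [p j] becomes a_j (1 - t), which forces a_j = 0; the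
    other weights are then unchanged. *)
Lemma affinely_independent_move (R : realType) (n : nat)
    (p : 'I_n.+1 -> 'rV[R]_n) (i j : 'I_n.+1) (t : R) :
  i != j -> t < 1 -> affinely_independent p ->
  affinely_independent (move_vertex p i j t).
Proof.
move=> ij t1 /affinely_independentP pI; apply/affinely_independentP => a a0.
rewrite sum_move_vertex => /pI; rewrite sum_transfer => /(_ a0) b0.
have [Ei Ej El] := transferE a (a j * t) ij.
have aj : a j = 0.
  have := b0 j; rewrite Ej => /eqP.
  have -> : a j - a j * t = a j * (1 - t) by ring.
  rewrite mulf_eq0 => /orP[/eqP//|]; lra.
move=> l; have [->//|lj] := eqVneq l j.
have := b0 l; have [->|li] := eqVneq l i; last by rewrite El.
by rewrite Ei aj mul0r addr0.
Qed.

Lemma hull_move_sub (R : realType) (n k : nat) (p : 'I_k -> 'rV[R]_n)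
    (i j : 'I_k) (t : R) : i != j -> 0 <= t <= 1 ->
  hull (move_vertex p i j t) `<=` hull p.
Proof.
move=> ij /andP[t0 t1] x [a [a0 a1 ->]]; exists (transfer a i j (a j * t)).
split; [|by rewrite sum_transfer|exact: sum_move_vertex].
have at0 : 0 <= a j * t by exact: mulr_ge0.
apply: transfer_ge0 => //; first by have := a0 i; lra.
by rewrite ler_piMr.
Qed.

(** Solving for [p j] in terms of the moved vertex gives the latter the weight a_j / (1 - t) and
    leaves a_i - t a_j / (1 - t) for [p i]; the last hypothesis makes this nonnegative. *)
Lemma mem_hull_move (R : realType) (n k : nat) (p : 'I_k -> 'rV[R]_n)
    (i j : 'I_k) (t : R) (a : 'I_k -> R) : i != j -> 0 <= t < 1 ->
  (forall l, 0 <= a l) -> \sum_l a l = 1 -> t * a j <= (1 - t) * a i ->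
  hull (move_vertex p i j t) (\sum_l a l *: p l).
Proof.
move=> ij /andP[t0 t1] a0 a1 le_a; pose s := a j / (1 - t).
have t1' : 0 < 1 - t by lra.
have sE : s * (1 - t) = a j by rewrite divfK ?gt_eqF.
have s0 : 0 <= s by rewrite divr_ge0// ltW.
have [Ei Ej El] := transferE a (- (s * t)) ij.
exists (transfer a i j (- (s * t))); split; last 1 first.
- rewrite sum_move_vertex !sum_transfer_scale Ej -addrA -scalerDl.
  have -> : - (s * t) + (a j - - (s * t)) * t = 0.
    by rewrite -sE; ring.
  by rewrite scale0r addr0.
- apply: transfer_ge0 => //; last first.
    by have := a0 j; have := mulr_ge0 s0 t0; lra.
  rewrite lerN2 -(ler_pM2l t1'); apply: le_trans le_a.
  by rewrite -sE le_eqVlt; apply/orP; left; apply/eqP; ring.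
- by rewrite sum_transfer.
Qed.

Definition affine_fun (R : realType) (n : nat) (f : 'rV[R]_n -> R) : Prop :=
  forall (k : nat) (a : 'I_k -> R) (p : 'I_k -> 'rV[R]_n), \sum_i a i = 1 ->
    f (\sum_i a i *: p i) = \sum_i a i * f (p i).

Lemma affine_move_vertex (R : realType) (n k : nat) (f : 'rV[R]_n -> R)
    (p : 'I_k -> 'rV[R]_n) (i j : 'I_k) (t : R) :
  affine_fun f ->
  f (p j + t *: (p i - p j)) = f (p j) + t * (f (p i) - f (p j)).
Proof.
move=> fA; pose a (l : 'I_2) : R := if l == ord0 then 1 - t else t.
pose q (l : 'I_2) := if l == ord0 then p j else p i.
have a1 : \sum_l a l = 1 by rewrite !big_ord_recl big_ord0 /a /=; lra.
have := fA _ a q a1; rewrite !big_ord_recl !big_ord0 /a /q /= !addr0.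
have -> : (1 - t) *: p j + t *: p i = p j + t *: (p i - p j).
  by rewrite scalerBl scale1r scalerBr addrAC addrA.
by move=> ->; ring.
Qed.

(* The vertex in D required of every simplex keeps later cuts full-dimensional:
   a half-space whose interior contains D meets each simplex in a polytope. *)
Inductive simplicial (R : realType) (n : nat) (D : set 'rV[R]_n) :
    set 'rV[R]_n -> Prop :=
| simplicial_hull p :
    affinely_independent p -> (exists i, D (p i)) -> simplicial D (hull p)
| simplicialU A B : simplicial D A -> simplicial D B -> simplicial D (A `|` B).

Lemma simplicial_polytope (R : realType) (n : nat) (D A : set 'rV[R]_n) :
  simplicial D A -> polytope A.
Proof.
elim=> [p pI _|{}A B _ [k [S [SF ->]]] _ [l [T [TF ->]]]].
  exists 0%N, (fun=> hull p); split; first by move=> _; exists p.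
  by apply/seteqP; split=> [x px|x [_ _ //]]; exists ord0.
(* The number of simplices, [(k + l.+1).+1], computes to [k.+1 + l.+1], so an index splits into the
   two families. *)
exists (k + l.+1)%N,
  (fun i => match fintype.split (i : 'I_(k.+1 + l.+1)) with
            | inl a => S a | inr b => T b end); split.
  by move=> i; case: fintype.split.
apply/seteqP; split=> x.
  case=> -[i _ Hx].
    by exists (lshift l.+1 i) => //; rewrite (unsplitK (inl i)).
  by exists (rshift k.+1 i) => //; rewrite (unsplitK (inr i)).
by case=> i _; case: fintype.split => j Hx; [left|right]; exists j.
Qed.

(* Splitting an edge whose ends have opposite signs at its zero replaces the
   simplex by two simplices with fewer vertices off the hyperplane f = 0. *)
Lemma simplicial_cut_hull (R : realType) (n : nat) (f : 'rV[R]_n -> R)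
    (D : set 'rV[R]_n) (p : 'I_n.+1 -> 'rV[R]_n) :
  affine_fun f -> f @^-1` [set 0] `<=` D -> affinely_independent p ->
  (exists i, D (p i)) -> (exists i, 0 < f (p i)) ->
  simplicial D (hull p `&` [set x | 0 <= f x]).
Proof.
move=> fA fD; have [N] := ubnP #|[set i | f (p i) != 0]%SET|.
elim: N p => // N IH p ltN pI pD [i fi].
have [[j fj]|nneg] := pselect (exists j, f (p j) < 0); last first.
  suff -> : hull p `&` [set x | 0 <= f x] = hull p by exact: simplicial_hull.
  apply/setIidPl => _ [a [a0 a1 ->]] /=; rewrite fA//; apply: sumr_ge0 => l _.
  apply: mulr_ge0 => //; rewrite leNgt; apply/negP => fl.
  by apply: nneg; exists l.
have ij : i != j by apply: contraTneq fi => ->; rewrite -leNgt ltW.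
have ji : j != i by rewrite eq_sym.
(* The zero of f on the edge from [p j] to [p i] is at parameter t. It replaces [p j] in q and [p i]
   in r. *)
pose t := f (p j) / (f (p j) - f (p i)).
have dN : f (p j) - f (p i) < 0 by lra.
have tE : t * (f (p j) - f (p i)) = f (p j) by rewrite divfK ?lt_eqF.
have t0 : 0 < t by rewrite /t nmulr_rgt0 ?invr_lt0.
have t1 : t < 1.
  rewrite -subr_gt0; have : (1 - t) * (f (p j) - f (p i)) < 0.
    by rewrite mulrBl tE mul1r; lra.
  by rewrite nmulr_llt0.
pose q := move_vertex p i j t; pose r := move_vertex p j i (1 - t).
have qj : f (q j) = 0.
  by rewrite /q /move_vertex eqxx affine_move_vertex//; lra.
have ri : f (r i) = 0.
  by rewrite /r /move_vertex eqxx affine_move_vertex//; lra.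
have ql l : l != j -> q l = p l by rewrite /q /move_vertex => /negbTE ->.
have rl l : l != i -> r l = p l by rewrite /r /move_vertex => /negbTE ->.
have qI : affinely_independent q by exact: affinely_independent_move.
have rI : affinely_independent r.
  by apply: affinely_independent_move => //; lra.
have hE : hull p = hull q `|` hull r.
  apply/seteqP; split=> [_ [a [a0 a1 ->]]|x [|]]; last 2 first.
  - by apply: hull_move_sub => //; rewrite !ltW.
  - by apply: hull_move_sub => //; lra.
  (* The two cases are the two sides of the hyperplane through the zero on the edge and the vertices
     other than [p i] and [p j]. *)
  have [le_a|/ltW le_a] := leP (t * a j) ((1 - t) * a i).
    by left; apply: mem_hull_move => //; rewrite t1 ltW.
  right; apply: mem_hull_move => //; first lra.
  by have -> : 1 - (1 - t) = t by ring.
have smaller (z : 'I_n.+1 -> 'rV[R]_n) (l0 : 'I_n.+1) : f (p l0) != 0 ->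
    f (z l0) = 0 -> (forall l, l != l0 -> z l = p l) ->
    (#|[set i | f (z i) != 0%R]%SET| < N)%N.
  move=> pl0 zl0 zE; rewrite -ltnS; apply: leq_trans ltN; rewrite ltnS.
  apply: proper_card; apply/properP; split.
    apply/fintype.subsetP => l; rewrite !inE; have [->|/zE ->//] := eqVneq l l0.
    by rewrite zl0 eqxx.
  by exists l0; rewrite !inE// zl0 eqxx.
(* The new vertex is a zero of f and so lies in D, even if [p j] was the only vertex in D; [p i]
   remains a vertex with f > 0. *)
have qS : simplicial D (hull q `&` [set x | 0 <= f x]).
  apply: IH => //; first by apply: (smaller q j) => //; rewrite lt_eqF.
    by exists j; apply: fD.
  by exists i; rewrite ql.
have [[k fk]|npos] := pselect (exists k, 0 < f (r k)).
  rewrite hE setIUl; apply: simplicialU => //; apply: IH => //.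
  - by apply: (smaller r i) => //; rewrite gt_eqF.
  - by exists i; apply: fD.
  - by exists k.
(* Here f <= 0 on hull r, so f = 0 holds on a face of hull r only, and all
   vertices of that face are vertices of q. *)
suff -> : hull p `&` [set x | 0 <= f x] = hull q `&` [set x | 0 <= f x] by [].
rewrite hE setIUl; apply/setUidPl => x [[a [a0 a1 ->]]] /= fx; split => //.
have rN l : f (r l) <= 0.
  by rewrite leNgt; apply/negP => fl; apply: npos; exists l.
have aj : a j = 0.
  have : - (\sum_l a l * f (r l)) <= 0 by rewrite oppr_le0 -fA.
  rewrite -sumrN (bigD1 j)//= => le0.
  have : 0 <= \sum_(l < n.+1 | l != j) - (a l * f (r l)).
    by apply: sumr_ge0 => l _; rewrite oppr_ge0 mulr_ge0_le0.
  move: le0; rewrite rl// => le0 ge0.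
  have /eqP : a j * f (p j) = 0.
    by apply/eqP; rewrite eq_le mulr_ge0_le0 ?(ltW fj)//=; lra.
  by rewrite mulf_eq0 => /orP[/eqP//|/eqP]; lra.
(* In terms of p, the weights at j and i are now a_i (1 - t) and a_i t, the equality case of the
   criterion in [mem_hull_move]. *)
have [Ej Ei _] := transferE a (a i * (1 - t)) ji.
rewrite sum_move_vertex; apply: mem_hull_move => //.
- by rewrite t1 ltW.
- have ai := a0 i; have s0 : 0 <= a i * (1 - t) by apply: mulr_ge0 => //; lra.
  have s1 : 0 <= a i * t by apply: mulr_ge0 => //; lra.
  by apply: transfer_ge0 => //; lra.
- by rewrite sum_transfer.
- by rewrite Ej Ei aj; lra.
Qed.

(** With the open half-space as D, every simplex of A has a vertex where f > 0, so each can be cut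
    separately. *)
Lemma simplicial_cut (R : realType) (n : nat) (f : 'rV[R]_n -> R)
    (A : set 'rV[R]_n) :
  affine_fun f -> simplicial [set x | 0 < f x] A ->
  simplicial setT (A `&` [set x | 0 <= f x]).
Proof.
move=> fA; elim=> [p pI [i fi]|{}A B _ AS _ BS].
  by apply: simplicial_cut_hull => //; exists i.
by rewrite setIUl; apply: simplicialU.
Qed.

Lemma polytope_affine_image (R : realType) (n : nat) (A : 'M[R]_n)
    (b : 'rV[R]_n) (P : set 'rV[R]_n) : A \in unitmx -> polytope P ->
  polytope ((fun x => x *m A + b) @` P).
Proof.
move=> Au [k [S [SF ->]]].
exists k, (fun i => (fun x => x *m A + b) @` S i); split; last first.
  by rewrite image_bigcup.
move=> i; have [p [pI ->]] := SF i.
have gE (a : 'I_n.+1 -> R) :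
    \sum_l a l *: (p l *m A + b) = (\sum_l a l *: p l) *m A + (\sum_l a l) *: b.
  under eq_bigr do rewrite scalerDr scalemxAl.
  by rewrite big_split/= -mulmx_suml scaler_suml.
exists (fun l => p l *m A + b); split.
  move/affinely_independentP : pI => pI; apply/affinely_independentP => a a0.
  rewrite gE a0 scale0r addr0 => pA; apply: pI => //.
  by rewrite -[LHS](mulmxK Au) pA mul0mx.
apply/seteqP; split=> [_ [_ [a [a0 a1 ->]] <-]|_ [a [a0 a1 ->]]].
  by exists a; split=> //; rewrite gE a1 scale1r.
by exists (\sum_l a l *: p l); [exists a|rewrite gE a1 scale1r].
Qed.

(** From a common interior point, a short step along d stays in A but pushes the functional c
    strictly above t. *)
Lemma interiors_separated (R : realType) (n : nat) (c : 'cV[R]_n.+1)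
    (d : 'rV[R]_n.+1) (t : R) (A B : set 'rV[R]_n.+1) :
  0 < (d *m c) 0 0 -> (forall x, A x -> (x *m c) 0 0 <= t) ->
  (forall x, B x -> t <= (x *m c) 0 0) -> A° `&` B° = set0.
Proof.
move=> fd fA fB; apply/seteqP; split=> // x [Ax /interior_subset /fB tx].
have /nbhs_ballP [e e0 sub] : nbhs x A := Ax.
pose h := e / 2 / (`|d| + 1).
have d1 : 0 < `|d| + 1 by apply: ltr_wpDl.
have h0 : 0 < h by rewrite !divr_gt0.
have hE : h * (`|d| + 1) = e / 2 by rewrite divfK ?gt_eqF.
have : A (x + h *: d).
  apply: sub; rewrite -ball_normE /= opprD addNKr normrN normrZ gtr0_norm//.
  by rewrite mulrDr mulr1 in hE; move: e0 => /= e0; lra.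
move/fA; rewrite mulmxDl -scalemxAl [X in X <= _ -> _]mxE [X in _ + X]mxE.
have : 0 < h * (d *m c) 0 0 by exact: mulr_gt0.
by lra.
Qed.

(** * The layers of the simplex and the slab in coordinates *)

Definition chain_simplex (R : realType) (n : nat) : set 'rV[R]_n :=
  [set a | (forall i, 0 <= a 0 i <= 1) /\
           forall i j : 'I_n, (i <= j)%N -> a 0 j <= a 0 i].

Definition coord_sum (R : realType) (n : nat) (a : 'rV[R]_n) : R :=
  \sum_i a 0 i.

Definition layer (R : realType) (n k : nat) : set 'rV[R]_n :=
  @chain_simplex R n `&` [set a | k%:R <= coord_sum a <= k.+1%:R].

Definition chain_vertex (R : realType) (n : nat) (i : 'I_n.+1) : 'rV[R]_n :=
  \row_j (j < i)%:R.

Lemma sum_chain_vertex (R : realType) (n : nat) (a : 'I_n.+1 -> R) (j : 'I_n) :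
  (\sum_i a i *: chain_vertex R i) 0 j = \sum_(i < n.+1 | (j < i)%N) a i.
Proof.
rewrite summxE [RHS]big_mkcond; apply: eq_bigr => i _.
by rewrite !mxE; case: ifP => _; rewrite ?mulr1 ?mulr0.
Qed.

(** The coordinates of a combination are tail sums of its weights, and each weight is a difference
    of consecutive tail sums. *)
Lemma affinely_independent_chain (R : realType) (n : nat) :
  affinely_independent (@chain_vertex R n).
Proof.
apply/affinely_independentP => a a0 /rowP ap0.
pose tail k := \sum_(i < n.+1 | (k <= i)%N) a i.
have tail0 k : (k <= n.+1)%N -> tail k = 0.
  case: k => [|k] kn; first by rewrite -[RHS]a0; apply: eq_bigl.
  have [kn'|nk] := ltnP k n.
    by have := ap0 (Ordinal kn'); rewrite sum_chain_vertex mxE.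
  by rewrite /tail big_pred0// => i; apply/negbTE;
     rewrite -ltnNge (leq_trans (ltn_ord i)).
move=> i; have := tail0 i (ltnW (ltn_ord i)).
rewrite /tail (bigD1 i)//= (eq_bigl (fun l : 'I_n.+1 => (i.+1 <= l)%N)).
  by rewrite -/(tail i.+1) tail0// addr0.
by move=> l; rewrite [RHS]ltn_neqAle andbC eq_sym.
Qed.

Lemma chain_simplex_hull (R : realType) (n : nat) :
  @chain_simplex R n = hull (@chain_vertex R n).
Proof.
apply/seteqP; split=> [x [x01 xdec]|_ [a [a0 a1 ->]]].
  (* The sequence e is 1, x_1, ..., x_n, 0, the final 0 coming from the failing [insub]. Its
     successive drops are the barycentric weights. *)
  pose e k : R := if k is k'.+1 then
    (if insub k' is Some i then x 0 i else 0) else 1.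
  have eS (i : 'I_n) : e i.+1 = x 0 i by rewrite /e valK.
  have en : e n.+1 = 0 by rewrite /e insubF// ltnn.
  have e01 k : 0 <= e k <= 1.
    by case: k => [|k]; rewrite /e ?ler01 ?lexx//; case: insubP => //=;
       rewrite ?ler01 ?lexx.
  have edec k : (k <= n)%N -> e k.+1 <= e k.
    case: k => [_|k kn]; first by case/andP: (e01 1%N).
    have [kn'|nk] := ltnP k.+1 n; last first.
      have -> : k.+1 = n by lia.
      by rewrite en; case/andP: (e01 n).
    by rewrite (eS (Ordinal kn')) (eS (Ordinal kn)); apply: xdec => /=.
  have telesc k : (k <= n.+1)%N ->
      \sum_(i < n.+1 | (k <= i)%N) (e i - e i.+1) = e k.
    move=> kn; transitivity (\sum_(k <= i < n.+1) (e i - e i.+1)).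
      by rewrite big_geq_mkord.
    rewrite (eq_bigr (fun i => - (e i.+1 - e i))); last by move=> i _; ring.
    by rewrite sumrN telescope_sumr// en; ring.
  exists (fun i => e i - e i.+1); split.
  - by move=> i; rewrite subr_ge0 edec// -ltnS.
  - by rewrite -[RHS](telesc 0%N)//; apply: eq_bigl.
  - by apply/rowP => j; rewrite sum_chain_vertex telesc ?eS// ltnS ltnW.
split=> [i|i j ij]; rewrite !sum_chain_vertex.
  rewrite sumr_ge0//= -a1 [leRHS](bigID (fun l : 'I_n.+1 => (i < l)%N))/=.
  by rewrite lerDl sumr_ge0.
rewrite big_mkcond [leRHS]big_mkcond/=; apply: ler_sum => l _.
case: ifP => jl; last by case: ifP.
by rewrite (leq_ltn_trans ij jl).
Qed.

Lemma coord_sum_vertex (R : realType) (n : nat) (i : 'I_n.+1) :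
  coord_sum (chain_vertex R i) = i%:R.
Proof.
rewrite /coord_sum; under eq_bigr do rewrite mxE.
rewrite -natr_sum; congr (_%:R); rewrite -[RHS]card_ord -sum1_card.
rewrite -big_mkcond/= (big_ord_narrow (leq_ord i)).
by [].
Qed.

Lemma affine_coord_sum (R : realType) (n : nat) (s b : R) :
  affine_fun (fun x : 'rV[R]_n => s * coord_sum x + b).
Proof.
move=> k a p a1; under [RHS]eq_bigr do rewrite mulrDr.
rewrite big_split/= -mulr_suml a1 mul1r; congr (_ + _).
rewrite /coord_sum (eq_bigr _ (fun i _ => summxE _ _ _ 0 i)).
rewrite exchange_big/= mulr_sumr; apply: eq_bigr => i _.
rewrite !mulr_sumr; apply: eq_bigr => j _.
by rewrite mxE mulrCA.
Qed.

(** The cut at sum k comes first, with D the open half-space below sum k + 1. D contains the first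
    cutting hyperplane and the vertex of index k, so the second cut is again full-dimensional; the
    last vertex has sum n > k. *)
Lemma polytope_layer (R : realType) (n k : nat) : (k < n)%N ->
  polytope (@layer R n k).
Proof.
move=> kn; pose f x : R := 1 * @coord_sum R n x + - k%:R.
pose g x : R := -1 * @coord_sum R n x + k.+1%:R.
have -> : @layer R n k = hull (@chain_vertex R n) `&` [set x | 0 <= f x]
    `&` [set x | 0 <= g x].
  rewrite /layer chain_simplex_hull -setIA; congr (_ `&` _).
  apply/seteqP; rewrite /f /g; split=> x /= => [/andP[? ?]|[? ?]]; last lra.
  by split; lra.
apply: (@simplicial_polytope _ _ setT); apply: simplicial_cut.
  exact: affine_coord_sum.
apply: simplicial_cut_hull.
- exact: affine_coord_sum.
- by move=> x /=; rewrite /f /g -natr1; lra.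
- exact: affinely_independent_chain.
- exists (inord k); rewrite /= /g coord_sum_vertex inordK; last lia.
  by rewrite -natr1; lra.
- exists ord_max; rewrite /f coord_sum_vertex/=.
  by rewrite mul1r subr_gt0 ltr_nat.
Qed.

Lemma bigcup_layer (R : realType) (n : nat) :
  @chain_simplex R n.+1 = \bigcup_(k : 'I_n.+1) @layer R n.+1 k.
Proof.
apply/seteqP; split=> [x xC|x [k _ []//]]; have [x01 _] := xC.
have ex : exists k, coord_sum x <= k.+1%:R.
  exists n; rewrite -[n.+1%:R](_ : \sum_(i < n.+1) 1 = _).
    by apply: ler_sum => i _; case/andP: (x01 i).
  by rewrite sumr_const card_ord.
(* Minimality of k gives the lower bound k on the sum, except for k = 0, where the coordinates are
   nonnegative anyway. *)
case: (ex_minnP ex) => k xk kmin.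
have kn : (k < n.+1)%N.
  rewrite ltnS; apply: kmin; rewrite -[n.+1%:R](_ : \sum_(i < n.+1) 1 = _).
    by apply: ler_sum => i _; case/andP: (x01 i).
  by rewrite sumr_const card_ord.
exists (Ordinal kn) => //; split=> //=; rewrite xk andbT.
case: k xk kmin {kn} => [_ _|k _ kmin].
  by apply: sumr_ge0 => i _; case/andP: (x01 i).
by rewrite leNgt; apply/negP => /ltW /kmin; rewrite ltnn.
Qed.

(** * Rolling the layers back into the slab *)

Definition rotation (m : nat) (k : 'I_m.+1) : {perm 'I_m.+1} :=
  perm (@addIr _ k).

(* The inverse k-th power of the motion sending (a_1, ..., a_n) to
   (a_n + 1, a_1, ..., a_(n-1)), which preserves the infinite prism
   a_1 >= ... >= a_n >= a_1 - 1. *)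
Definition unroll (R : realType) (m : nat) (k : 'I_m.+1) (a : 'rV[R]_m.+1) :
    'rV[R]_m.+1 :=
  \row_i (a 0 (i + k) - (m.+1 <= i + k)%N%:R).

Lemma unrollE (R : realType) (m : nat) (k : 'I_m.+1) (a : 'rV[R]_m.+1) :
  unroll k a = a *m perm_mx (rotation k)^-1 + unroll k 0.
Proof. by rewrite -col_permE; apply/rowP => i; rewrite !mxE permE sub0r. Qed.

Lemma val_addord (m : nat) (i k : 'I_m.+1) :
  val (i + k) = (if m.+1 <= i + k then i + k - m.+1 else i + k)%N.
Proof.
have := ltn_ord i; have := ltn_ord k => km im /=.
case: ltnP => h; last by rewrite modn_small.
by rewrite -[in LHS](subnK h) modnDr modn_small//; lia.
Qed.

Lemma val_subord (m : nat) (i k : 'I_m.+1) :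
  val (i - k) = (if k <= i then i - k else i + m.+1 - k)%N.
Proof.
have := val_addord (i - k) k; rewrite subrK.
move: (i - k) => j /=; move: (ltn_ord i) (ltn_ord j) (ltn_ord k).
by case: ifP; case: ifP; lia.
Qed.

(** Permuting the coordinates keeps their sum, and exactly k of them wrap around and lose 1. *)
Lemma coord_sum_unroll (R : realType) (m : nat) (k : 'I_m.+1)
    (a : 'rV[R]_m.+1) : coord_sum (unroll k a) = coord_sum a - k%:R.
Proof.
rewrite /coord_sum; under eq_bigr do rewrite mxE.
rewrite sumrB; congr (_ - _).
  by rewrite [RHS](reindex_inj (@addIr _ k)).
(* Reversing the order turns the wrapped positions, the last k, into the first k. *)
rewrite -natr_sum; congr (_%:R); rewrite (reindex_inj rev_ord_inj)/=.
rewrite (eq_bigr (fun i : 'I_m.+1 => (i < k)%N : nat)); last first.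
  by move=> i _; congr (nat_of_bool _); have := ltn_ord i; lia.
rewrite -big_mkcond/= (big_ord_narrow (ltnW (ltn_ord k))).
by rewrite sum1_card card_ord.
Qed.

Definition prism_coords (R : realType) (n : nat) : set 'rV[R]_n :=
  [set a : 'rV[R]_n | [/\ forall i j : 'I_n, (i <= j)%N -> a 0 j <= a 0 i,
               forall i j : 'I_n, a 0 i <= a 0 j + 1
             & 0 <= coord_sum a <= 1]].

(** The new sequence is a_(k+1), ..., a_n, a_1 - 1, ..., a_k - 1: its first part lies in [0, 1] and
    its second in [-1, 0], so it still decreases, and its ends differ by at most 1 because a_(k+1)
    <= a_k. *)
Lemma unroll_layer (R : realType) (m : nat) (k : 'I_m.+1) :
  @unroll R m k @` @layer R m.+1 k `<=` @prism_coords R m.+1.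
Proof.
move=> _ [a [[a01 adec] /= /andP[sk skS]] <-].
split=> [i j ij|i j|]; last by rewrite coord_sum_unroll -natr1 in skS *; lra.
  have /andP[ai0 ai1] := a01 (i + k); have /andP[aj0 aj1] := a01 (j + k).
  have := adec (i + k) (j + k); rewrite !mxE -![nat_of_ord (_ + _)]/(val _).
  rewrite !val_addord; case: (ltnP m (i + k)) => h1;
    case: (ltnP m (j + k)) => h2; rewrite /= ?mulr1n ?mulr0n.
  - by move=> /(_ ltac:(lia)); lra.
  - by lia.
  - by lra.
  - by move=> /(_ ltac:(lia)); lra.
have /andP[ai0 ai1] := a01 (i + k); have /andP[aj0 aj1] := a01 (j + k).
have := adec (j + k) (i + k); rewrite !mxE -![nat_of_ord (_ + _)]/(val _).
rewrite !val_addord; have jm := ltn_ord j; case: (ltnP m (i + k)) => h1;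
  case: (ltnP m (j + k)) => h2; rewrite /= ?mulr1n ?mulr0n; try lra.
by move=> /(_ ltac:(lia)); lra.
Qed.

(** A point of the slab comes from the layer whose index is the number of its negative coordinates.
    These stand at the end and are the ones that wrapped around. *)
Lemma bigcup_unroll (R : realType) (m : nat) :
  @prism_coords R m.+1 =
  \bigcup_(k : 'I_m.+1) @unroll R m k @` @layer R m.+1 k.
Proof.
apply/seteqP; split=> [x [xdec xgap /andP[s0 s1]]|x [k _ /unroll_layer//]].
have ex : exists N, [forall i : 'I_m.+1, (N <= i)%N ==> (x 0 i < 0)].
  by exists m.+1; apply/forallP => i; rewrite leqNgt ltn_ord.
case: (ex_minnP ex) => N /forallP Nneg Nmin.
have NM : (N <= m.+1)%N.
  by apply: Nmin; apply/forallP => i; rewrite leqNgt ltn_ord.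
have xneg (i : 'I_m.+1) : (N <= i)%N -> x 0 i < 0.
  by move=> Ni; have := Nneg i; rewrite Ni.
have xpos (i : 'I_m.+1) : (i < N)%N -> 0 <= x 0 i.
  case: N Nmin xneg NM {Nneg} => // N Nmin xneg NM iN.
  rewrite leNgt; apply/negP => xi.
  suff /Nmin : [forall i : 'I_m.+1, (N <= i)%N ==> (x 0 i < 0)] by rewrite ltnn.
  apply/forallP => j; apply/implyP => Nj; apply: le_lt_trans xi.
  by apply: xdec; lia.
have N0 : (0 < N)%N.
  rewrite lt0n; apply/negP => /eqP N0; move: s0; rewrite leNgt => /negP; apply.
  rewrite /coord_sum big_ord_recl; apply: ltr_wnDr.
    by apply: sumr_le0 => i _; rewrite ltW// xneg// N0.
  by rewrite xneg// N0.
(* A coordinate above 1 would make all others positive and the sum exceed 1; dually, one below -1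
   would make the sum negative. *)
have x1 l : x 0 l <= 1.
  rewrite leNgt; apply/negP => xl; move: s1; rewrite leNgt => /negP; apply.
  rewrite /coord_sum (bigD1 l)//=; apply: ltr_wpDr => //.
  by apply: sumr_ge0 => i _; have := xgap l i; lra.
have xN1 l : -1 <= x 0 l.
  rewrite leNgt; apply/negP => xl; move: s0; rewrite leNgt => /negP; apply.
  rewrite /coord_sum (bigD1 l)//=; apply: ltr_wnDr; last lra.
  by apply: sumr_le0 => i _; have := xgap i l; lra.
have kM : (m.+1 - N < m.+1)%N by lia.
pose k : 'I_m.+1 := Ordinal kM.
(* Undo [unroll]: bring the last k coordinates to the front and add 1 to each. *)
pose a : 'rV[R]_m.+1 := \row_i (x 0 (i - k) + (i < k)%N%:R).
have ax : unroll k a = x.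
  apply/rowP => i; rewrite !mxE addrK -[nat_of_ord (i + k)]/(val _) val_addord.
  have im := ltn_ord i; have km := ltn_ord k; case: (ltnP m (i + k)) => h.
    have -> : (i + k - m.+1 < k)%N by lia.
    by rewrite addrK.
  have -> : (i + k < k)%N = false by lia.
  by rewrite subr0 addr0.
exists k => //; exists a => //; split; last first.
  by move: s0 s1; rewrite -ax coord_sum_unroll /= -[_.+1%:R]natr1; lra.
have aE i : a 0 i = x 0 (i - k) + (i < k)%N%:R by rewrite mxE.
split=> [i|i j ij].
  rewrite aE; have := x1 (i - k); have := xN1 (i - k).
  have := xneg (i - k); have := xpos (i - k).
  rewrite -![nat_of_ord (_ - _)]/(val _) val_subord; have := ltn_ord i.
  case: (leqP k i) => ki im; rewrite /= ?mulr1n ?mulr0n.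
    by move=> /(_ ltac:(lia)) *; lra.
  by move=> _ /(_ ltac:(lia)) *; lra.
rewrite !aE; have := xdec (i - k) (j - k); have := xgap (j - k) (i - k).
rewrite -![nat_of_ord (_ - _)]/(val _) !val_subord.
case: (leqP k i) => ki; case: (leqP k j) => kj; rewrite /= ?mulr1n ?mulr0n.
- by move=> _ /(_ ltac:(lia)); lra.
- by lia.
- by move=> + _; lra.
- by move=> _ /(_ ltac:(lia)); lra.
Qed.

(** * Frames and isometries *)

Lemma dotvE (R : realType) (n : nat) (x y : 'rV[R]_n) :
  dotv x y = (x *m y^T) 0 0.
Proof. by rewrite mxE; apply: eq_bigr => i _; rewrite mxE. Qed.

Lemma orthogonal_isometry (R : realType) (n : nat) (M : 'M[R]_n)
    (b : 'rV[R]_n) : M *m M^T = 1%:M ->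
  euclidean_isometry (fun x => x *m M + b).
Proof.
move=> MM; have M'M := mulmx1C MM; split.
  exists (fun y => (y - b) *m M^T) => x; first by rewrite addrK -mulmxA MM mulmx1.
  by rewrite -mulmxA M'M mulmx1 subrK.
move=> x y; rewrite /Defs.edist opprD addrACA subrr addr0 -mulmxBl !dotvE.
by rewrite trmx_mul mulmxA -(mulmxA _ M) MM mulmx1.
Qed.

Definition frame_mx (R : realType) (n : nat) (v : 'I_n -> 'rV[R]_n) : 'M[R]_n :=
  \matrix_i v i.

Lemma mul_frame_mx (R : realType) (n : nat) (v : 'I_n -> 'rV[R]_n)
    (a : 'rV[R]_n) : a *m frame_mx v = \sum_i a 0 i *: v i.
Proof. by rewrite mulmx_sum_row; under eq_bigr do rewrite rowK. Qed.

Lemma Qsimplex_image (R : realType) (n : nat) (v : 'I_n -> 'rV[R]_n) :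
  Qsimplex v = (fun a => a *m frame_mx v) @` @chain_simplex R n.
Proof.
apply/seteqP; split=> [_ [a [a01 adec ->]]|_ [a [a01 adec] <-]].
  exists (\row_i a i); last first.
    by rewrite mul_frame_mx; under eq_bigr do rewrite mxE.
  by split=> [i|i j ij]; rewrite !mxE//; apply: adec.
by exists (a 0); split=> //; exact: mul_frame_mx.
Qed.

Definition gram (R : realType) (n : nat) (w : R) : 'M[R]_n :=
  (1 + w)%:M - w *: const_mx 1.

Lemma Qframe_dotv (R : realType) (n : nat) (w : R) (v : 'I_n -> 'rV[R]_n) :
  Qframe w v <-> forall i j, dotv (v i) (v j) = (1 + w) * (i == j)%:R - w.
Proof.
split=> [[v1 vw] i j|vE].
  have [->|ij] := eqVneq i j; first by rewrite v1 mulr1; ring.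
  by rewrite vw// mulr0 sub0r.
split=> [i|i j /negbTE ij]; rewrite vE ?eqxx ?ij /= ?mulr1n ?mulr0n; ring.
Qed.

Lemma frame_gram (R : realType) (n : nat) (w : R) (v : 'I_n -> 'rV[R]_n) :
  Qframe w v -> frame_mx v *m (frame_mx v)^T = gram n w.
Proof.
move=> /Qframe_dotv vE; apply/matrixP => i j.
rewrite !mxE mulr1 -mulr_natr -vE; apply: eq_bigr => k _.
by rewrite !mxE.
Qed.

(** With J the all-ones matrix, the Gram matrix (1 + w) I - w J has eigenvalues 1 + w and 1 - m w.
    Since J^2 = (m + 1) J, its inverse is again a combination of I and J. *)
Lemma gram_unit (R : realType) (m : nat) (w : R) :
  1 + w != 0 -> 1 - m%:R * w != 0 -> exists G, gram m.+1 w *m G = 1%:M.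
Proof.
move=> w1 wm.
exists ((1 + w)^-1%:M + (w / (1 + w) / (1 - m%:R * w)) *: const_mx 1).
pose J : 'M[R]_m.+1 := const_mx 1; have JJ : J *m J = m.+1%:R *: J.
  apply/matrixP => i j; rewrite !mxE; under eq_bigr do rewrite !mxE mulr1.
  by rewrite sumr_const card_ord mulr1.
rewrite /gram mulmxDl !mulmxDr mulNmx -!scalemxAl -!scalemxAr.
rewrite !mul_scalar_mx mul_mx_scalar mulNmx -!scalemxAl JJ.
apply/matrixP => i j; rewrite !mxE -[m.+1%:R]natr1 -[_ *+ (i == j)]mulr_natl.
case: (i == j) => /=; rewrite ?mulr1n ?mulr0n; field; exact/andP.
Qed.

Lemma frame_unit (R : realType) (m : nat) (w : R) (v : 'I_m.+1 -> 'rV[R]_m.+1) :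
  1 + w != 0 -> 1 - m%:R * w != 0 -> Qframe w v -> frame_mx v \in unitmx.
Proof.
move=> w1 wm /frame_gram vG; have [G] := gram_unit w1 wm.
by rewrite -vG -mulmxA => /mulmx1_unit[].
Qed.

Lemma gram_perm (R : realType) (n : nat) (w : R) (s : 'S_n) :
  perm_mx s *m gram n w *m (perm_mx s)^T = gram n w.
Proof.
rewrite /gram mulmxBr mulmxBl mul_mx_scalar -scalemxAl tr_perm_mx -perm_mxM.
rewrite mulgV perm_mx1 -scalemxAr -scalemxAl -row_permE -col_permE.
rewrite scale_scalar_mx mulr1; congr (_ - _ *: _).
by apply/matrixP => i j; rewrite !mxE.
Qed.

(** Both frames have the same permutation-invariant Gram matrix, so one may permute the coordinates
    and change frames in a single isometry. *)
Lemma frame_perm_orthogonal (R : realType) (m : nat) (w : R)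
    (v v' : 'I_m.+1 -> 'rV[R]_m.+1) (s : 'S_m.+1) :
  1 + w != 0 -> 1 - m%:R * w != 0 -> Qframe w v -> Qframe w v' ->
  let M := invmx (frame_mx v) *m perm_mx s *m frame_mx v' in M *m M^T = 1%:M.
Proof.
move=> w1 wm vQ v'Q M; have Vu := frame_unit w1 wm vQ.
have -> : M *m M^T = invmx (frame_mx v) *m
    (perm_mx s *m (frame_mx v' *m (frame_mx v')^T) *m (perm_mx s)^T)
    *m (invmx (frame_mx v))^T.
  by rewrite /M !trmx_mul !mulmxA.
rewrite (frame_gram v'Q) gram_perm -(frame_gram vQ) mulmxA mulVmx// mul1mx.
by rewrite -trmx_mul mulVmx// trmx1.
Qed.

(* Up to the scaling by c, these are the projections of v_1, ..., v_n onto the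
   hyperplane orthogonal to their sum. *)
Definition regular_ext (R : realType) (m : nat) (u : 'I_m -> 'rV[R]_m)
    (i : 'I_m.+1) : 'rV[R]_m :=
  if unlift ord_max i is Some j then u j else - \sum_j u j.

(** For w = 1/m the sum of the u_j is a unit vector with product 1/m with each u_i, so its negative
    completes them to the vertices of a regular simplex centred at 0. *)
Lemma regular_ext_dotv (R : realType) (m : nat) (u : 'I_m -> 'rV[R]_m)
    (i j : 'I_m.+1) : (0 < m)%N -> Qframe m%:R^-1 u ->
  dotv (regular_ext u i) (regular_ext u j) =
  (1 + m%:R^-1) * (i == j)%:R - m%:R^-1.
Proof.
move=> m0 /Qframe_dotv uE.
have m0' : m%:R != 0 :> R by rewrite pnatr_eq0 -lt0n.
have us i' : dotv (u i') (\sum_j u j) = m%:R^-1.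
  rewrite dotvE raddf_sum mulmx_sumr summxE; under eq_bigr do rewrite -dotvE uE.
  rewrite sumrB -mulr_sumr sumr_const card_ord -[_^-1 *+ _]mulr_natr mulVf//.
  have := sum_delta i' (fun=> 1 : R^o).
  under eq_bigr do rewrite /GRing.scale/= mulr1 eq_sym.
  by move=> ->; ring.
have dC (x y : 'rV[R]_m) : dotv x y = dotv y x.
  by apply: eq_bigr => k _; rewrite mulrC.
have dN (x y : 'rV[R]_m) : dotv x (- y) = - dotv x y.
  by rewrite !dotvE linearN mulmxN mxE.
have ss : dotv (\sum_j u j) (\sum_j u j) = 1.
  rewrite {1}dotvE mulmx_suml summxE; under eq_bigr do rewrite -dotvE us.
  by rewrite sumr_const card_ord -[LHS]mulr_natr mulVf.
rewrite /regular_ext; case: unliftP => [i' ->|->]; case: unliftP => [j' ->|->].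
- by rewrite uE (inj_eq lift_inj).
- by rewrite dN us eq_sym (negbTE (neq_lift _ _)) mulr0 sub0r.
- by rewrite dC dN us (negbTE (neq_lift _ _)) mulr0 sub0r.
- by rewrite dN dC dN ss eqxx mulr1 opprK; ring.
Qed.

(** All vectors get the same height l over a centred regular simplex, so the height of a point is l
    times its coordinate sum. *)
Definition prism_frame (R : realType) (m : nat) (u : 'I_m -> 'rV[R]_m)
    (c l : R) (i : 'I_m.+1) : 'rV[R]_m.+1 :=
  \row_j (if unlift ord_max j is Some k then c * regular_ext u i 0 k else l).

Lemma widen_lift_max (m : nat) (h : (m <= m.+1)%N) (j : 'I_m) :
  widen_ord h j = lift ord_max j.
Proof. by apply: ord_inj; rewrite lift_max. Qed.

(** The constants solve c^2 (1 + 1/m) = 1 + w and c^2 / m - l^2 = w. *)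
Lemma prism_frame_Qframe (R : realType) (m : nat) (w : R)
    (u : 'I_m -> 'rV[R]_m) : (0 < m)%N -> -1 < w -> w < m%:R^-1 ->
  Qframe m%:R^-1 u ->
  Qframe w (prism_frame u (Num.sqrt (m%:R * (w + 1) / m.+1%:R))
                          (Num.sqrt ((1 - w * m%:R) / m.+1%:R))).
Proof.
move=> m0 w1 wm uQ; set c := Num.sqrt _; set l := Num.sqrt _.
have m0' : 0 < m%:R :> R by rewrite ltr0n.
have c2 : c ^+ 2 = m%:R * (w + 1) / m.+1%:R.
  by rewrite sqr_sqrtr// divr_ge0// mulr_ge0//; lra.
have l2 : l ^+ 2 = (1 - w * m%:R) / m.+1%:R.
  rewrite sqr_sqrtr// divr_ge0// subr_ge0 ltW//.
  by rewrite -ltr_pdivlMr// div1r.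
apply/Qframe_dotv => i j.
rewrite /dotv big_ord_recr /= !mxE !unlift_none.
under eq_bigr do rewrite !mxE widen_lift_max liftK mulrACA.
rewrite -mulr_sumr -[X in _ * X + _ = _]/(dotv _ _) regular_ext_dotv//.
rewrite -!expr2 c2 l2 -natr1; field.
by rewrite gt_eqF//= gt_eqF// ltr_wpDr.
Qed.

(** The vectors of [regular_ext u] sum to 0, so the base point depends only on the differences a_i -
    a_n, while a common shift of the coordinates moves along the axis. *)
Lemma prism_image (R : realType) (m : nat) (u : 'I_m -> 'rV[R]_m) (c l : R) :
  0 < l -> @prism R m.+1 (scale_set c (Qsimplex u)) l =
  (fun a => a *m frame_mx (prism_frame u c l)) @` @prism_coords R m.+1.
Proof.
move=> l0.
have last (a : 'rV[R]_m.+1) :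
    (a *m frame_mx (prism_frame u c l)) 0 ord_max = l * coord_sum a.
  rewrite mul_frame_mx summxE mulr_sumr; apply: eq_bigr => i _.
  by rewrite !mxE unlift_none mulrC.
have base (a : 'rV[R]_m.+1) (h : (m <= m.+1)%N) :
    \row_j (a *m frame_mx (prism_frame u c l)) 0 (widen_ord h j) =
    c *: \sum_i (a 0 (lift ord_max i) - a 0 ord_max) *: u i.
  apply/rowP => j; rewrite mxE mul_frame_mx summxE widen_lift_max.
  transitivity (\sum_i c * (a 0 i * regular_ext u i 0 j)).
    by apply: eq_bigr => i _; rewrite !mxE liftK; ring.
  rewrite -mulr_sumr mxE; congr (_ * _).
  rewrite big_ord_recr /= {2}/regular_ext unlift_none mxE !summxE -sumrN.
  rewrite mulr_sumr -big_split/=; apply: eq_bigr => i _.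
  by rewrite /regular_ext widen_lift_max liftK !mxE; ring.
apply/seteqP; split=> [x [[y [a [a01 adec ->]] yx] xl]|_ [a [adec agap] as01 <-]].
  have /andP[x0 x1] := xl ord_max erefl.
  (* The common shift b brings the coordinate sum to the height of x divided by l. *)
  pose b := (x 0 ord_max / l - \sum_i a i) / m.+1%:R.
  pose a' : 'rV[R]_m.+1 :=
    \row_i ((if unlift ord_max i is Some j then a j else 0) + b).
  have al j : a' 0 (lift ord_max j) = a j + b by rewrite mxE liftK.
  have am : a' 0 ord_max = b by rewrite mxE unlift_none add0r.
  have as' : coord_sum a' = x 0 ord_max / l.
    rewrite /coord_sum big_ord_recr /= am.
    under eq_bigr do rewrite widen_lift_max al.
    rewrite big_split/= sumr_const card_ord -mulr_natr -addrA.
    rewrite -[X in _ + (_ + X)]mulr1 -mulrDr natr1 divfK ?pnatr_eq0//; ring.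
  exists a'; last first.
    apply/rowP => j; case: (unliftP ord_max j) => [k ->|->]; last first.
      by rewrite last as' mulrC divfK ?gt_eqF.
    have := base a' (leq_pred m.+1); rewrite -(widen_lift_max (leq_pred m.+1)).
    move/rowP/(_ k); rewrite mxE => ->; move/rowP/(_ k): yx; rewrite [in RHS]mxE.
    by move=> <-; under eq_bigr do rewrite al am addrK.
  have a01' i : 0 <= a i /\ a i <= 1 by apply/andP.
  split=> [i j|i j|].
  - case: (unliftP ord_max i) => [i' ->|->];
      case: (unliftP ord_max j) => [j' ->|->].
    + by rewrite !lift_max !al lerD2r; exact: adec.
    + by rewrite al am; have [] := a01' i'; lra.
    + by rewrite lift_max /= leqNgt ltn_ord.
    + by [].
  - case: (unliftP ord_max i) => [i' ->|->];
      case: (unliftP ord_max j) => [j' ->|->].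
    + by rewrite !al; have [] := a01' i'; have [] := a01' j'; lra.
    + by rewrite al am; have [] := a01' i'; lra.
    + by rewrite al am; have [] := a01' j'; lra.
    + by lra.
  - by rewrite as' divr_ge0 ?(ltW l0)//= ler_pdivrMr// mul1r.
split; last first.
  move=> i im; have -> : i = ord_max by exact: val_inj.
  rewrite last; case/andP: as01 => s0 s1.
  by rewrite mulr_ge0 ?(ltW l0)//= ler_piMr// ltW.
rewrite base; exists (\sum_i (a 0 (lift ord_max i) - a 0 ord_max) *: u i) => //.
exists (fun i => a 0 (lift ord_max i) - a 0 ord_max); split=> //.
- move=> i; rewrite subr_ge0 adec ?leq_ord//=.
  by rewrite lerBlDl agap.
- by move=> i j ij; rewrite lerB// adec// !lift_max.
Qed.

(** * Disjoint interiors and the dissection *)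

Lemma trivIset_ord (T : Type) (n : nat) (F : 'I_n -> set T) :
  (forall j k : 'I_n, (j < k)%N -> F j `&` F k = set0) -> trivIset setT F.
Proof.
move=> F0; apply/trivIsetP => j k _ _ jk.
have : (j : nat) != k by [].
by rewrite neq_ltn => /orP[]/F0; rewrite // setIC.
Qed.

(** For j < k the hyperplane of coordinate sum k separates the layers j and k. *)
Lemma layer_interiors (R : realType) (m : nat) (V : 'M[R]_m.+1) :
  V \in unitmx -> trivIset setT
    (fun k : 'I_m.+1 => ((fun a => a *m V) @` @layer R m.+1 k)°).
Proof.
move=> Vu; apply: trivIset_ord => j k jk.
pose c : 'cV[R]_m.+1 := invmx V *m const_mx 1.
have cE a : (a *m V *m c) 0 0 = coord_sum a.
  rewrite /c mulmxA mulmxK// mxE; apply: eq_bigr => i _.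
  by rewrite mxE mulr1.
apply: (@interiors_separated _ _ c (const_mx 1 *m V) k%:R).
- rewrite cE /coord_sum; under eq_bigr do rewrite mxE.
  by rewrite sumr_const card_ord ltr0n.
- move=> _ [a [_ /= /andP[_ aj]] <-]; rewrite cE (le_trans aj)// ler_nat.
  exact: jk.
- by move=> _ [a [_ /= /andP[ak _]] <-]; rewrite cE.
Qed.

(** For j < k the coordinate at position n - k, counted from 0, separates the pieces: in piece k it
    is a_1 - 1 <= 0, whereas in piece j it has not wrapped and is nonnegative. *)
Lemma unroll_interiors (R : realType) (m : nat) (V : 'M[R]_m.+1) :
  V \in unitmx -> trivIset setT (fun k : 'I_m.+1 =>
    ((fun a => unroll k a *m V) @` @layer R m.+1 k)°).
Proof.
move=> Vu; apply: trivIset_ord => j k jk.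
have k0 : (0 < k)%N by lia.
pose c : 'cV[R]_m.+1 := invmx V *m delta_mx (- k) 0.
have cE a : (a *m V *m c) 0 0 = a 0 (- k).
  by rewrite /c mulmxA mulmxK// -colE mxE.
have valN : val (- k) = (m.+1 - k)%N.
  by have := val_subord 0 k; rewrite sub0r leqNgt k0.
rewrite setIC; apply: (@interiors_separated _ _ c (delta_mx 0 (- k) *m V) 0).
- by rewrite cE mxE !eqxx.
- move=> _ [a [[a01 _] _] <-]; rewrite cE mxE addNr.
  have -> : (m.+1 <= - k + k)%N.
    by rewrite -[nat_of_ord (- k)]/(val _) valN subnK// ltnW.
  by case/andP: (a01 0) => _; rewrite /= mulr1n; lra.
- move=> _ [a [[a01 _] _] <-]; rewrite cE mxE.
  have -> : (m.+1 <= - k + j)%N = false.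
    by rewrite -[nat_of_ord (- k)]/(val _) valN; have := ltn_ord k; lia.
  by rewrite subr0; case/andP: (a01 (- k + j)).
Qed.

Theorem mainTheorem2 (R : realType) (n : nat) (w : R)
    (v : 'I_n -> 'rV[R]_n) (u : 'I_n.-1 -> 'rV[R]_n.-1) :
  (2 <= n)%N ->
  -1 < w -> w < (n.-1%:R)^-1 ->
  Qframe w v ->
  Qframe (n.-1%:R)^-1 u ->
  let c := Num.sqrt (n.-1%:R * (w + 1) / n%:R) in
  let l := Num.sqrt ((1 - w * n.-1%:R) / n%:R) in
  exists (P Q : 'I_n -> set 'rV[R]_n) (g : 'I_n -> 'rV[R]_n -> 'rV[R]_n),
    [/\ dissection (Qsimplex v) P,
        dissection (prism (scale_set c (Qsimplex u)) l) Q,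
        forall i, euclidean_isometry (g i)
      & forall i, g i @` P i = Q i].
Proof.
case: n v u => // m v u m0 w1 wm vQ uQ c l; rewrite /= in wm uQ c l *.
have wm0 : 0 < 1 - w * m%:R.
  by rewrite subr_gt0 -ltr_pdivlMr ?div1r// ltr0n.
have l0 : 0 < l by rewrite sqrtr_gt0 divr_gt0.
pose V := frame_mx v; pose W := frame_mx (prism_frame u c l).
have w1' : 1 + w != 0 by rewrite gt_eqF//; lra.
have wm' : 1 - m%:R * w != 0 by rewrite mulrC gt_eqF.
have pQ : Qframe w (prism_frame u c l) by exact: prism_frame_Qframe.
have Vu : V \in unitmx := frame_unit w1' wm' vQ.
have Wu : W \in unitmx := frame_unit w1' wm' pQ.
pose P (k : 'I_m.+1) := (fun a => a *m V) @` @layer R m.+1 k.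
pose Q (k : 'I_m.+1) := (fun a => unroll k a *m W) @` @layer R m.+1 k.
(* Read the coordinates in the frame v, unroll them, and use them in the frame of the prism. *)
pose g (k : 'I_m.+1) (x : 'rV[R]_m.+1) :=
  x *m (invmx V *m perm_mx (rotation k)^-1 *m W) + unroll k 0 *m W.
have gE k a : g k (a *m V) = unroll k a *m W.
  by rewrite /g !mulmxA mulmxK// (unrollE _ a) mulmxDl.
have gP k : g k @` P k = Q k.
  by rewrite /P /Q image_comp; apply: eq_imagel => a _; rewrite /= gE.
have gI k : euclidean_isometry (g k).
  exact: (orthogonal_isometry _ (frame_perm_orthogonal _ w1' wm' vQ pQ)).
have Ppoly k : polytope (P k).
  have := polytope_affine_image 0 Vu (polytope_layer R (ltn_ord k)).
  by congr polytope; apply: eq_imagel => a _; rewrite addr0.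
exists P, Q, g; split=> //; split.
- exact: Ppoly.
- by rewrite Qsimplex_image bigcup_layer image_bigcup.
- exact: layer_interiors.
- move=> k; rewrite -gP; apply: polytope_affine_image => //.
  by rewrite !unitmx_mul unitmx_inv Vu unitmx_perm Wu.
- rewrite prism_image// bigcup_unroll image_bigcup.
  by apply: eq_bigcupr => k _; rewrite image_comp.
- exact: unroll_interiors.
Qed.
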